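(* Let $\alpha,\beta\in\mathbb{R}$ with $|\alpha|\neq|\beta|$, and let $p\in\mathbb{N}$ be odd. Suppose both $|\alpha/\beta|$ and $|\beta/\alpha|$ are not in $\mathcal{F}_p$. Then, with $q=1$ in the definition of $\Xi_n$, $$\mathcal{I}_{p,1}(\alpha,\beta)=\int_0^\infty\frac{(\cos\alpha x-\cos\beta x)^p}{x}\,dx=\sum_{n=1}^{N-1}\Xi_n\log\left|\frac{\chi_{r_{n+1}}(1)}{\chi_{r_n}(1)}\right|.$$
   Context: $\mathbb{N}=\{1,2,3,\ldots\}$. The integral is an improper (Riemann) integral at both endpoints ($\lim$ of $\int_\varepsilon^R$ as $\varepsilon\to0^+$, $R\to\infty$). The set $\mathcal{F}_p$. Let $b\in\mathbb{N}$ be odd and $a\in\{0,1,\ldots,b-1\}$. Put $m_{a,b}:=\max\{0,a-(b-1)/2\}$, $$\mathcal{R}_{a,b}:=\left\{a-2k : k\in\mathbb{Z},\ m_{a,b}\le k\le\left\lfloor\tfrac a2\right\rfloor\right\},$$ $$\mathcal{F}_{a,b}:=\left\{\frac rs\in[0,1) : r\in\mathcal{R}_{a,b},\ s\in\{r+1,r+3,\ldots,b-a\}\right\},$$ where $\{r+1,r+3,\ldots,b-a\}$ is the set of integers $s$ with $r+1\le s\le b-a$ and $s-r$ odd (empty if $r+1>b-a$), and $\mathcal{F}_b:=\bigcup_{a\in\{0,1,\ldots,(b-1)/2\}}\mathcal{F}_{a,b}$. (If one of $\alpha,\beta$ is $0$, then one of the two ratios equals $0\in\mathcal{F}_p$,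 so this case is excluded by the hypothesis.) Notation for the formula. Fix $\alpha,\beta,p,q$. Let $$\Omega_1:=\{(k,\ell,m)\in(\mathbb{N}\cup\{0\})^3 : 0\le k\le p-1,\ 0\le\ell\le p-k-1,\ 0\le m\le k\},$$ $$\Omega_2:=\{(p,\ell,0) : \ell\in\mathbb{N}\cup\{0\},\ 0\le\ell\le p-1\},\qquad \Omega:=\Omega_1\cup\Omega_2.$$ For $(k,\ell,m)\in\Omega$ put $$\Lambda_{k,\ell,m}:=\begin{cases}\dfrac{(-1)^k}{2^{p-1}}\dbinom pk\dbinom{p-k-1}{\ell}\dbinom km & \text{if }k\in\{0,1,\ldots,p-1\},\\[2mm] \dfrac{(-1)^p}{2^{p-1}}\dbinom{p-1}{\ell} & \text{if }k=p,\end{cases}$$ $$\chi_{k,\ell,m}(x):=\begin{cases}(p-k-2\ell)\alpha x+(k-2m)\beta x & \text{if }k\in\{0,1,\ldots,p-1\},\\ (p-2\ell)\beta x & \text{if }k=p.\end{cases}$$ Let $\tilde\Omega:=\{(k,\ell,m)\in\Omega : \chi_{k,\ell,m}(1)\neq0\}$, and let $r_1,r_2,\ldots,r_N$ be an enumeration (in any order, without repetition) of the elements of $\tilde\Omega$, so $N=|\tilde\Omega|$. For $1\le n\le N$ put $$\Xi_n:=\sum_{j=1}^n\Lambda_{r_j}\,(\chi_{r_j}(1))^{q-1}.$$ *)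

(* Defs.v *)
From Stdlib Require Import Reals ZArith Arith.
From Coquelicot Require Import Coquelicot.
Open Scope R_scope.

(** [in_Rab], [in_Fab] and [in_F] use [Z], so that all subtractions are exact. *)

Definition m_ab (a b : Z) : Z := Z.max 0 (a - (b - 1) / 2)%Z.

Definition in_Rab (a b r : Z) : Prop :=
  exists k : Z, (m_ab a b <= k <= a / 2)%Z /\ r = (a - 2 * k)%Z.

Definition in_Fab (a b : Z) (x : R) : Prop :=
  exists r s : Z,
    in_Rab a b r /\
    (r + 1 <= s <= b - a)%Z /\ Z.Odd (s - r) /\
    x = IZR r / IZR s /\ 0 <= x < 1.

Definition in_F (b : Z) (x : R) : Prop :=
  exists a : Z, (0 <= a <= (b - 1) / 2)%Z /\ in_Fab a b x.

Definition triple : Type := (nat * nat * nat)%type.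

Definition Omega1 (p : nat) (t : triple) : Prop :=
  let '(k, l, m) := t in
  (k <= p - 1 /\ l <= p - k - 1 /\ m <= k)%nat.

Definition Omega2 (p : nat) (t : triple) : Prop :=
  let '(k, l, m) := t in
  (k = p /\ l <= p - 1 /\ m = 0)%nat.

Definition Omega (p : nat) (t : triple) : Prop := Omega1 p t \/ Omega2 p t.

(** [Lambda] and [chi] are only meaningful on [Omega p], where the [else]
    branch is the case [k = p].  [Binomial.C] is the binomial coefficient
    (unqualified [C] is Coquelicot's type of complex numbers). *)

Definition Lambda (p : nat) (t : triple) : R :=
  let '(k, l, m) := t in
  if (k <? p)%nat then
    (-1) ^ k / 2 ^ (p - 1)
      * Binomial.C p k * Binomial.C (p - k - 1) l * Binomial.C k m
  else
    (-1) ^ p / 2 ^ (p - 1) * Binomial.C (p - 1) l.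

Definition chi (alpha beta : R) (p : nat) (t : triple) (x : R) : R :=
  let '(k, l, m) := t in
  if (k <? p)%nat then
    (INR p - INR k - 2 * INR l) * alpha * x + (INR k - 2 * INR m) * beta * x
  else
    (INR p - 2 * INR l) * beta * x.

Definition OmegaTilde (alpha beta : R) (p : nat) (t : triple) : Prop :=
  Omega p t /\ chi alpha beta p t 1 <> 0.

(** [r 1, ..., r N] lists the elements of [A] without repetition; the values
    of [r] outside [1..N] are irrelevant. *)

Definition is_enumeration (A : triple -> Prop) (N : nat) (r : nat -> triple) : Prop :=
  (forall j, (1 <= j <= N)%nat -> A (r j)) /\
  (forall i j, (1 <= i <= N)%nat -> (1 <= j <= N)%nat -> r i = r j -> i = j) /\
  (forall t, A t -> exists j, (1 <= j <= N)%nat /\ r j = t).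

Definition Xi (alpha beta : R) (p q : nat) (r : nat -> triple) (n : nat) : R :=
  sum_n_m (fun j => Lambda p (r j) * chi alpha beta p (r j) 1 ^ (q - 1)) 1 n.

(* Main.v *)
Require Import Defs.
From Stdlib Require Import Reals ZArith Arith.
From Coquelicot Require Import Coquelicot.
From Stdlib Require Import List Permutation Lia Lra.
Open Scope R_scope.

(** The numerator of the integrand is a trigonometric polynomial,
    [Rsum (fun t => Lambda p t * cos (chi alpha beta p t 1 * x))] over the triples
    of [Omega p] ([cos_minus_cos_pow]). At [x = 0] it vanishes, so the weights
    [Lambda p t] have sum zero.

    For such weights [lam] and nonzero frequencies [c], the integral of
    [Rsum (fun a => lam a * cos (c a * x)) / x] over the positive half-line is
    [- Rsum (fun a => lam a * ln |c a|)] ([is_RInt_gen_frullani_cos]). The reason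
    is scaling: if [G] is a primitive of [cos x / x], then [G (|c| * x)] is a
    primitive of [cos (c * x) / x], and [G (|c| * x) - G x] tends to [ln |c|]
    at [0] and to [0] at infinity. The divergent part [G x] common to all terms
    is cancelled by the vanishing of the total weight.

    This needs every frequency to be nonzero, and that is what the hypotheses on
    [in_F] provide ([chi_neq_0]): as [p] is odd, a vanishing frequency would force
    one of the two ratios to be a fraction in [0, 1) of two integers of opposite
    parity with sum at most [p], and such fractions lie in [in_F]. Hence [OmegaTilde]
    is all of [Omega], and summation by parts ([Rsum_Abel]) along the given
    enumeration turns the sum of the [Lambda * ln |chi|] into the
    stated sum; the boundary term carries the total weight, which is zero. *)

(** * Finite real sums over lists *)

(** A summation over an arbitrary list rather than over an interval of
    indices: the triples of [Omega] are most naturally listed by nested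
    concatenations, and two lists of the same triples are compared by
    [Permutation]. *)
Definition Rsum {A : Type} (F : A -> R) (s : list A) : R :=
  fold_right (fun a acc => F a + acc) 0 s.

Lemma Rsum_app {A : Type} (F : A -> R) (s t : list A) :
  Rsum F (s ++ t) = Rsum F s + Rsum F t.
Proof. induction s as [|a s IH]; simpl; [ring | rewrite IH; ring]. Qed.

Lemma Rsum_map {A B : Type} (F : B -> R) (f : A -> B) (s : list A) :
  Rsum F (map f s) = Rsum (fun a => F (f a)) s.
Proof. induction s as [|a s IH]; simpl; [ring | rewrite IH; ring]. Qed.

Lemma Rsum_flat_map {A B : Type} (F : B -> R) (f : A -> list B) (s : list A) :
  Rsum F (flat_map f s) = Rsum (fun a => Rsum F (f a)) s.
Proof.
  induction s as [|a s IH]; simpl; [ring | rewrite Rsum_app, IH; ring].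
Qed.

Lemma Rsum_ext {A : Type} (F G : A -> R) (s : list A) :
  (forall a, In a s -> F a = G a) -> Rsum F s = Rsum G s.
Proof.
  induction s as [|a s IH]; simpl; intros H; [ring|].
  rewrite H, IH; auto.
Qed.

Lemma Rsum_scal {A : Type} (c : R) (F : A -> R) (s : list A) :
  Rsum (fun a => c * F a) s = c * Rsum F s.
Proof. induction s as [|a s IH]; simpl; [ring | rewrite IH; ring]. Qed.

Lemma Rsum_plus {A : Type} (F G : A -> R) (s : list A) :
  Rsum (fun a => F a + G a) s = Rsum F s + Rsum G s.
Proof. induction s as [|a s IH]; simpl; [ring | rewrite IH; ring]. Qed.

Lemma Rsum_Permutation {A : Type} (F : A -> R) (s t : list A) :
  Permutation s t -> Rsum F s = Rsum F t.
Proof. induction 1; simpl; lra. Qed.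

Lemma Rsum_seq_S (F : nat -> R) (m n : nat) :
  Rsum F (seq m (S n)) = Rsum F (seq m n) + F (m + n)%nat.
Proof. rewrite seq_S, Rsum_app; simpl; ring. Qed.

Lemma Rsum_seq_S_l (F : nat -> R) (n : nat) :
  Rsum F (seq 0 (S n)) = F 0%nat + Rsum (fun i => F (S i)) (seq 0 n).
Proof. simpl. now rewrite <- seq_shift, Rsum_map. Qed.

Lemma sum_f_R0_Rsum (F : nat -> R) (n : nat) :
  sum_f_R0 F n = Rsum F (seq 0 (S n)).
Proof.
  induction n as [|n IH]; [simpl; ring|].
  rewrite tech5, IH, (Rsum_seq_S F 0 (S n)). reflexivity.
Qed.

Lemma sum_n_m_Rsum (F : nat -> R) (n : nat) :
  sum_n_m F 1 n = Rsum F (seq 1 n).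
Proof.
  induction n as [|n IH].
  - rewrite sum_n_m_zero; [reflexivity | lia].
  - rewrite sum_n_Sm, IH, Rsum_seq_S by lia. reflexivity.
Qed.

(** Summation by parts. The weight [F] is replaced by its partial sums, at the
    cost of one boundary term carrying the total sum, which vanishes in the
    application. *)
Lemma Rsum_Abel (F y : nat -> R) (n : nat) :
  Rsum (fun i => Rsum F (seq 1 i) * (y (i + 1)%nat - y i)) (seq 1 n)
  = Rsum F (seq 1 (S n)) * y (S n) - Rsum (fun i => F i * y i) (seq 1 (S n)).
Proof.
  induction n as [|n IH]; [simpl; ring|].
  rewrite Rsum_seq_S, IH, !(Rsum_seq_S _ 1 (S n)).
  replace (1 + n + 1)%nat with (S (S n)) by lia.
  simpl (1 + _)%nat. ring.
Qed.

Lemma is_derive_Rsum {A : Type} (F dF : A -> R -> R) (s : list A) (x : R) :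
  (forall a, In a s -> is_derive (F a) x (dF a x)) ->
  is_derive (fun y => Rsum (fun a => F a y) s) x (Rsum (fun a => dF a x) s).
Proof.
  induction s as [|a s IH]; simpl; intros H.
  - apply @is_derive_const.
  - apply @is_derive_plus; auto.
Qed.

Lemma filterlim_Rsum {A : Type} (F : A -> R -> R) (l : A -> R) (s : list A)
  (D : (R -> Prop) -> Prop) {FD : Filter D} :
  (forall a, In a s -> filterlim (F a) D (locally (l a))) ->
  filterlim (fun y => Rsum (fun a => F a y) s) D (locally (Rsum l s)).
Proof.
  induction s as [|a s IH]; simpl; intros H.
  - apply filterlim_const.
  - eapply filterlim_comp_2.
    + apply H; auto.
    + apply IH; auto.
    + apply (filterlim_plus (l a) (Rsum l s)).
Qed.

(** * A Frullani integral for cosine sums of total weight zero *)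

Lemma lipschitz_of_derive_bound (f df : R -> R) (a b K : R) :
  (forall x, Rmin a b <= x <= Rmax a b -> is_derive f x (df x)) ->
  (forall x, Rmin a b <= x <= Rmax a b -> Rabs (df x) <= K) ->
  Rabs (f b - f a) <= K * Rabs (b - a).
Proof.
  intros Hd HK.
  destruct (MVT_gen f a b df) as [c [Hc ->]].
  - intros x Hx; apply Hd; lra.
  - intros x Hx; apply derivable_continuous_pt; exists (df x).
    apply is_derive_Reals; auto.
  - rewrite Rabs_mult. apply Rmult_le_compat_r; [apply Rabs_pos | auto].
Qed.

Lemma Rabs_cos_minus_1_le (t : R) : Rabs (cos t - 1) <= Rabs t.
Proof.
  rewrite <- cos_0, <- (Rminus_0_r t) at 1.
  replace (Rabs t) with (1 * Rabs (t - 0)) by (rewrite Rminus_0_r; ring).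
  rewrite Rminus_0_r at 1.
  apply (lipschitz_of_derive_bound cos (fun x => - sin x)).
  - intros x _. auto_derive; [auto | ring].
  - intros x _. rewrite Rabs_Ropp. apply Rabs_le, SIN_bound.
Qed.

(** The primitive is the cosine integral up to a constant. Only its derivative
    matters below, because it is only ever used through its increments. *)
Lemma ex_primitive_cos_div :
  exists G : R -> R, forall x, 0 < x -> is_derive G x (cos x / x).
Proof.
  exists (RInt (fun t => cos t / t) 1). intros x Hx.
  assert (Hc : forall t, 0 < t -> continuous (fun t => cos t / t) t).
  { intros t Ht. apply (ex_derive_continuous (fun t => cos t / t)).
    auto_derive; lra. }
  apply (is_derive_RInt (fun t => cos t / t) _ 1); [|apply Hc, Hx].
  exists (mkposreal x Hx). intros y Hy.
  apply (@RInt_correct R_CompleteNormedModule), (@ex_RInt_continuous R_CompleteNormedModule).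
  intros t Ht. apply Hc.
  change (Rabs (y - x) < x) in Hy. apply Rabs_def2 in Hy.
  assert (0 < Rmin 1 y) by (apply Rmin_glb_lt; lra). lra.
Qed.

Lemma dilation_segment_pos (c x t : R) :
  0 < c -> 0 < x -> Rmin x (c * x) <= t -> 0 < t.
Proof.
  intros Hc Hx Ht.
  assert (0 < Rmin x (c * x)) by (apply Rmin_glb_lt; nra). lra.
Qed.

(** Near [0] the function [cos x / x] is [/ x] plus a bounded function, so [G]
    and [ln] have asymptotically the same increment on the shrinking segment
    from [x] to [c * x]; that of [ln] is the constant [ln c]. *)
Lemma primitive_cos_div_dilation_0 (G : R -> R) (c : R) :
  (forall x, 0 < x -> is_derive G x (cos x / x)) ->
  0 < c ->
  filterlim (fun x => G (c * x) - G x) (at_right 0) (locally (ln c)).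
Proof.
  intros HG Hc. apply filterlim_locally. intros eps.
  assert (Hd : 0 < eps / (Rabs (c - 1) + 1)).
  { apply Rdiv_lt_0_compat; [apply cond_pos | pose proof (Rabs_pos (c - 1)); lra]. }
  exists (mkposreal _ Hd). intros x Hx Hx0.
  change (Rabs (x - 0) < eps / (Rabs (c - 1) + 1)) in Hx.
  change (Rabs (G (c * x) - G x - ln c) < eps).
  rewrite Rminus_0_r, (Rabs_pos_eq x) in Hx by lra.
  assert (H : Rabs ((G (c * x) - ln (c * x)) - (G x - ln x)) <= 1 * Rabs (c * x - x)).
  { apply (lipschitz_of_derive_bound (fun t => G t - ln t)
             (fun t => cos t / t - / t)).
    - intros t [Ht _].
      assert (0 < t) by (eapply dilation_segment_pos; [apply Hc | apply Hx0 | exact Ht]).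
      apply @is_derive_minus; [auto | apply is_derive_ln; auto].
    - intros t [Ht _].
      assert (0 < t) by (eapply dilation_segment_pos; [apply Hc | apply Hx0 | exact Ht]).
      replace (cos t / t - / t) with ((cos t - 1) / t) by (field; lra).
      unfold Rdiv. rewrite Rabs_mult, Rabs_inv, (Rabs_pos_eq t) by lra.
      pose proof (Rabs_cos_minus_1_le t) as Hcos. rewrite (Rabs_pos_eq t) in Hcos by lra.
      apply Rmult_le_reg_r with t; [auto|]. field_simplify; lra. }
  rewrite ln_mult in H by lra.
  replace (G (c * x) - (ln c + ln x) - (G x - ln x))
    with (G (c * x) - G x - ln c) in H by ring.
  replace (c * x - x) with ((c - 1) * x) in H by ring.
  rewrite Rabs_mult, (Rabs_pos_eq x) in H by lra.
  apply (Rmult_lt_compat_r (Rabs (c - 1) + 1)) in Hx;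
    [|pose proof (Rabs_pos (c - 1)); lra].
  unfold Rdiv in Hx. rewrite Rmult_assoc, Rinv_l in Hx
    by (pose proof (Rabs_pos (c - 1)); lra).
  lra.
Qed.

(** An integration by parts in disguise: [G - sin x / x] has derivative
    [sin x / x ^ 2], so its increment over a segment of length of order [x]
    at distance of order [x] from the origin is of order [/ x]. *)
Lemma primitive_cos_div_dilation_infty (G : R -> R) (c : R) :
  (forall x, 0 < x -> is_derive G x (cos x / x)) ->
  0 < c ->
  filterlim (fun x => G (c * x) - G x) (Rbar_locally p_infty) (locally 0).
Proof.
  intros HG Hc.
  set (m := Rmin 1 c).
  assert (Hm : 0 < m) by (apply Rmin_glb_lt; lra).
  (* [/ c] and [1] come from the boundary terms [sin y / y]; the last summand is
     the length of the segment times the bound on the derivative. *)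
  set (K := / c + 1 + Rabs (c - 1) / m ^ 2).
  assert (HK : 0 < K).
  { unfold K. assert (0 < / c) by (apply Rinv_0_lt_compat; auto).
    assert (0 <= Rabs (c - 1) / m ^ 2).
    { apply Rdiv_le_0_compat; [apply Rabs_pos | apply pow_lt; auto]. }
    lra. }
  assert (Hb : forall x, 0 < x -> Rabs (G (c * x) - G x) <= K / x).
  { intros x Hx0.
    assert (Hseg : forall t, Rmin x (c * x) <= t -> m * x <= t).
    { intros t Ht. apply Rle_trans with (2 := Ht).
      pose proof (Rmin_l 1 c). pose proof (Rmin_r 1 c).
      apply Rmin_glb; unfold m; nra. }
    assert (0 < m * x) by nra.
    assert (H1 : Rabs ((G (c * x) - sin (c * x) / (c * x)) - (G x - sin x / x))
                 <= / (m * x) ^ 2 * Rabs (c * x - x)).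
    { apply (lipschitz_of_derive_bound (fun t => G t - sin t / t)
               (fun t => sin t / t ^ 2)).
      - intros t [Ht _]. specialize (Hseg t Ht).
        replace (sin t / t ^ 2) with
          (cos t / t - (cos t * t - sin t) / t ^ 2) by (field; lra).
        apply @is_derive_minus; [apply HG; lra|].
        auto_derive; [lra | field; lra].
      - intros t [Ht _]. specialize (Hseg t Ht).
        assert (0 < (m * x) ^ 2) by (apply pow_lt; lra).
        unfold Rdiv. rewrite Rabs_mult, Rabs_inv, (Rabs_pos_eq (t ^ 2)) by nra.
        rewrite <- (Rmult_1_l (/ (m * x) ^ 2)).
        apply Rmult_le_compat; try apply Rabs_pos.
        + left; apply Rinv_0_lt_compat; apply pow_lt; lra.
        + apply Rabs_le, SIN_bound.
        + apply Rinv_le_contravar; [auto | apply pow_incr; lra]. }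
    assert (Hs : forall y, 0 < y -> Rabs (sin y / y) <= / y).
    { intros y Hy. unfold Rdiv. rewrite Rabs_mult, Rabs_inv, (Rabs_pos_eq y) by lra.
      rewrite <- (Rmult_1_l (/ y)) at 2. apply Rmult_le_compat_r.
      - left; apply Rinv_0_lt_compat; auto.
      - apply Rabs_le, SIN_bound. }
    pose proof (Hs x Hx0) as Hs1.
    assert (0 < c * x) by nra. pose proof (Hs (c * x) ltac:(auto)) as Hs2.
    replace (/ (m * x) ^ 2 * Rabs (c * x - x))
      with (Rabs (c - 1) / m ^ 2 / x) in H1.
    2:{ replace (c * x - x) with ((c - 1) * x) by ring.
        rewrite Rabs_mult, (Rabs_pos_eq x) by lra. field. lra. }
    replace (K / x) with (/ (c * x) + / x + Rabs (c - 1) / m ^ 2 / x)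
      by (unfold K; field; lra).
    revert H1 Hs1 Hs2. unfold Rabs. repeat destruct Rcase_abs; lra. }
  apply filterlim_locally. intros eps.
  exists (K / eps). intros x Hx.
  assert (0 < eps) by apply cond_pos.
  assert (0 < K / eps) by (apply Rdiv_lt_0_compat; auto).
  change (Rabs (G (c * x) - G x - 0) < eps). rewrite Rminus_0_r.
  apply Rle_lt_trans with (K / x); [apply Hb; lra|].
  apply Rmult_lt_reg_r with (x / eps); [apply Rdiv_lt_0_compat; lra|].
  field_simplify; lra.
Qed.

Lemma cos_Rabs_mult (c x : R) : cos (Rabs c * x) = cos (c * x).
Proof.
  unfold Rabs. destruct Rcase_abs; [|auto].
  rewrite <- (cos_neg (c * x)). f_equal; ring.
Qed.

(** Since the weights sum to zero, subtracting [cos x / x] from each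
    [cos (c a * x) / x] does not change the integrand. This yields a primitive
    [P] made of the increments of [G] between [x] and [|c a| * x], and each of
    them has a limit at both ends, although [G] itself has none at [0]. *)
Lemma is_RInt_gen_frullani_cos {A : Type} (s : list A) (lam c : A -> R) :
  Rsum lam s = 0 -> (forall a, In a s -> c a <> 0) ->
  is_RInt_gen (fun x => Rsum (fun a => lam a * cos (c a * x)) s / x)
    (at_right 0) (Rbar_locally p_infty)
    (- Rsum (fun a => lam a * ln (Rabs (c a))) s).
Proof.
  intros Hsum Hc.
  destruct ex_primitive_cos_div as [G HG].
  set (f := fun x => Rsum (fun a => lam a * cos (c a * x)) s / x).
  set (P := fun x => Rsum (fun a => lam a * (G (Rabs (c a) * x) - G x)) s).
  assert (HP : forall x, 0 < x -> is_derive P x (f x)).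
  { intros x Hx.
    assert (Hf : f x = Rsum (fun a =>
      lam a * (Rabs (c a) * (cos (Rabs (c a) * x) / (Rabs (c a) * x)) - cos x / x)) s).
    { transitivity (/ x * Rsum (fun a => lam a * cos (c a * x)) s
                    + - (cos x / x) * Rsum lam s).
      { rewrite Hsum; unfold f, Rdiv; ring. }
      rewrite <- 2!Rsum_scal, <- Rsum_plus. apply Rsum_ext. intros a Ha.
      rewrite cos_Rabs_mult. field. split; [lra|].
      now apply Rabs_no_R0, Hc. }
    rewrite Hf.
    apply (is_derive_Rsum (fun a x => lam a * (G (Rabs (c a) * x) - G x))
      (fun a x => lam a * (Rabs (c a) * (cos (Rabs (c a) * x) / (Rabs (c a) * x)) - cos x / x))).
    intros a Ha.
    assert (0 < Rabs (c a)) by (apply Rabs_pos_lt; auto).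
    apply is_derive_scal, @is_derive_minus; [|auto].
    apply (is_derive_comp G (fun x => Rabs (c a) * x)).
    - apply HG; nra.
    - auto_derive; [auto | ring]. }
  assert (Hf : forall x, 0 < x -> continuous f x).
  { intros x Hx. apply (ex_derive_continuous f).
    eexists. unfold f. apply is_derive_div; [| apply @is_derive_id | lra].
    apply (is_derive_Rsum (fun a x => lam a * cos (c a * x))
             (fun a x => lam a * (- sin (c a * x) * c a))).
    intros a _. auto_derive; [auto | ring]. }
  assert (Hpos : filter_prod (at_right 0) (Rbar_locally p_infty)
     (fun ab => forall x, Rmin (fst ab) (snd ab) <= x <= Rmax (fst ab) (snd ab) -> 0 < x)).
  { apply Filter_prod with (fun y => 0 < y) (fun y => 0 < y).
    - exists (mkposreal 1 Rlt_0_1). auto.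
    - exists 0. auto.
    - intros u v Hu Hv x Hx. assert (0 < Rmin u v) by (apply Rmin_glb_lt; auto).
      simpl in Hx; lra. }
  assert (HD : forall x, 0 < x -> locally x (fun y => Derive P y = f y)).
  { intros x Hx. exists (mkposreal x Hx). intros y Hy.
    change (Rabs (y - x) < x) in Hy. apply Rabs_def2 in Hy.
    apply is_derive_unique, HP; lra. }
  apply is_RInt_gen_ext with (Derive P).
  { revert Hpos. apply filter_imp. intros ab H x Hx.
    apply is_derive_unique, HP, H; lra. }
  replace (- Rsum (fun a => lam a * ln (Rabs (c a))) s) with
    (Rsum (fun a => lam a * 0) s - Rsum (fun a => lam a * ln (Rabs (c a))) s).
  2:{ replace (Rsum (fun a => lam a * 0) s) with 0; [ring|].
      rewrite (Rsum_ext _ (fun a => 0 * lam a)), Rsum_scal; intros; ring. }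
  apply is_RInt_gen_Derive.
  - revert Hpos. apply filter_imp. intros ab H x Hx.
    eexists. apply HP, (H x Hx).
  - revert Hpos. apply filter_imp. intros ab H x Hx.
    apply continuous_ext_loc with f; [|apply Hf, (H x Hx)].
    generalize (HD x (H x Hx)). apply filter_imp. auto.
  - apply filterlim_Rsum; [typeclasses eauto|]. intros a Ha.
    apply (filterlim_comp _ _ _ _ (fun y => lam a * y) _ _ _
      (primitive_cos_div_dilation_0 G (Rabs (c a)) HG (Rabs_pos_lt _ (Hc a Ha)))).
    apply (filterlim_scal_r (lam a) (ln (Rabs (c a)))).
  - apply filterlim_Rsum; [typeclasses eauto|]. intros a Ha.
    apply (filterlim_comp _ _ _ _ (fun y => lam a * y) _ _ _
      (primitive_cos_div_dilation_infty G (Rabs (c a)) HG (Rabs_pos_lt _ (Hc a Ha)))).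
    apply (filterlim_scal_r (lam a) 0).
Qed.

(** * Expansion of the integrand into cosines *)

Lemma binomial_0_r (n : nat) : Binomial.C n 0 = 1.
Proof.
  unfold Binomial.C. rewrite Nat.sub_0_r. simpl. field. apply INR_fact_neq_0.
Qed.

Lemma binomial_diag (n : nat) : Binomial.C n n = 1.
Proof.
  unfold Binomial.C. rewrite Nat.sub_diag. simpl. field. apply INR_fact_neq_0.
Qed.

Lemma Rsum_binomial_S (F : nat -> R) (n : nat) :
  Rsum (fun m => Binomial.C (S n) m * F m) (seq 0 (S (S n)))
  = Rsum (fun m => Binomial.C n m * F m) (seq 0 (S n))
  + Rsum (fun m => Binomial.C n m * F (S m)) (seq 0 (S n)).
Proof.
  rewrite Rsum_seq_S_l, Rsum_seq_S, (Rsum_seq_S_l _ n), (Rsum_seq_S (fun m => _ * F (S m)) 0 n).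
  simpl (0 + n)%nat. rewrite !binomial_0_r, !binomial_diag.
  rewrite (Rsum_ext _ (fun m => Binomial.C n (S m) * F (S m) + Binomial.C n m * F (S m))).
  - rewrite Rsum_plus. ring.
  - intros m Hm%in_seq. rewrite <- pascal by lia. ring.
Qed.

(** The real part of [exp (i theta) * (exp (i u) + exp (- i u)) ^ n], expanded
    by the binomial theorem. The induction goes through because the phase
    [theta] is arbitrary: Pascal's rule splits the sum into the two sums of
    phases [theta + u] and [theta - u]. Taking [theta = u] gives [cos u ^ (n + 1)]
    with only [n + 1] cosines, and taking for [theta] the argument of another
    cosine linearizes a product. *)
Lemma Rsum_binomial_cos (n : nat) (u theta : R) :
  Rsum (fun m => Binomial.C n m * cos (theta + (INR n - 2 * INR m) * u)) (seq 0 (S n))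
  = 2 ^ n * cos u ^ n * cos theta.
Proof.
  revert theta. induction n as [|n IH]; intros theta.
  - simpl. rewrite binomial_0_r.
    replace (theta + (0 - 2 * 0) * u) with theta by ring. ring.
  - rewrite (Rsum_binomial_S (fun m => cos (theta + (INR (S n) - 2 * INR m) * u))).
    transitivity (2 ^ n * cos u ^ n * cos (theta + u) + 2 ^ n * cos u ^ n * cos (theta - u)).
    + rewrite <- !IH. f_equal; apply Rsum_ext; intros m _; do 2 f_equal;
        rewrite !S_INR; ring.
    + rewrite cos_plus, cos_minus. simpl. ring.
Qed.

Definition Omega_list (p : nat) : list triple :=
  flat_map (fun k => flat_map (fun l => map (fun m => (k, l, m)) (seq 0 (S k)))
                       (seq 0 (p - k))) (seq 0 p)
  ++ map (fun l => (p, l, 0%nat)) (seq 0 p).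

Lemma in_Omega_list (p : nat) (t : triple) :
  (0 < p)%nat -> In t (Omega_list p) <-> Omega p t.
Proof.
  intros Hp. destruct t as [[k l] m]. unfold Omega_list, Omega, Omega1, Omega2.
  rewrite in_app_iff, in_map_iff, in_flat_map.
  setoid_rewrite in_flat_map. setoid_rewrite in_map_iff. setoid_rewrite in_seq.
  split.
  - intros [(k' & ? & l' & ? & m' & [= -> -> ->] & ?) | (l' & [= ? ? ?] & ?)]; lia.
  - intros [H | (-> & H & ->)].
    + left. exists k. split; [lia|]. exists l. split; [lia|]. exists m. split; [auto|lia].
    + right. exists l. split; [auto|lia].
Qed.

(** Disjointness of the blocks [f i] comes from [key], which recovers [i] from
    any element of [f i]. *)
Lemma NoDup_flat_map_key {A B : Type} (f : A -> list B) (key : B -> A) (s : list A) :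
  (forall i, NoDup (f i)) -> (forall i t, In t (f i) -> key t = i) ->
  NoDup s -> NoDup (flat_map f s).
Proof.
  intros Hf Hkey.
  induction s as [|i s IH]; intros Hs; simpl; [constructor|].
  apply NoDup_cons_iff in Hs as [Hi Hs].
  apply NoDup_app; auto.
  intros t Ht (j & Hj & Htj)%in_flat_map.
  apply Hi. now rewrite <- (Hkey i t Ht), (Hkey j t Htj).
Qed.

Lemma NoDup_Omega_list (p : nat) : NoDup (Omega_list p).
Proof.
  apply NoDup_app.
  - apply NoDup_flat_map_key with (key := fun t => fst (fst t)); [| |apply seq_NoDup].
    + intros k. apply NoDup_flat_map_key with (key := fun t => snd (fst t)); [| |apply seq_NoDup].
      * intros l. apply NoDup_map_NoDup_ForallPairs; [|apply seq_NoDup].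
        intros m m' _ _ [= ->]. reflexivity.
      * intros l t (m & <- & _)%in_map_iff. reflexivity.
    + intros k t (l & _ & (m & <- & _)%in_map_iff)%in_flat_map. reflexivity.
  - apply NoDup_map_NoDup_ForallPairs; [|apply seq_NoDup].
    intros l l' _ _ [= ->]. reflexivity.
  - intros t (k & Hk%in_seq & (l & _ & (m & <- & _)%in_map_iff)%in_flat_map)%in_flat_map.
    intros (l' & [= -> _ _] & _)%in_map_iff. lia.
Qed.

(** The binomial theorem in the two cosines, followed by [Rsum_binomial_cos]:
    for [k < p] once for the power of [cos (alpha * x)], with [theta = alpha * x],
    and once for the power of [cos (beta * x)], whose phase is then the current
    multiple of [alpha * x]. For [k = p] the first factor is absent and the
    reduction with [theta = beta * x] applies to the second one; this is why
    that case has its own formula. *)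
Lemma cos_minus_cos_pow (alpha beta x : R) (p : nat) :
  (0 < p)%nat ->
  (cos (alpha * x) - cos (beta * x)) ^ p
  = Rsum (fun t => Lambda p t * cos (chi alpha beta p t 1 * x)) (Omega_list p).
Proof.
  intros Hp. set (A := cos (alpha * x)). set (B := cos (beta * x)).
  assert (H2 : forall n, 2 ^ n <> 0) by (intros n; apply pow_nonzero; lra).
  unfold Rminus at 1. rewrite Rplus_comm, binomial, sum_f_R0_Rsum, Rsum_seq_S.
  simpl (0 + p)%nat. rewrite binomial_diag, Nat.sub_diag.
  unfold Omega_list. rewrite Rsum_app, Rsum_flat_map, Rsum_map. f_equal.
  - apply Rsum_ext. intros k Hk%in_seq. rewrite Rsum_flat_map.
    destruct (p - k)%nat as [|n] eqn:En; [lia|].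
    assert (Ep : INR p = INR k + INR (S n)) by (rewrite <- plus_INR; f_equal; lia).
    assert (E1 : (p - k - 1 = n)%nat) by lia.
    assert (E2 : (p - 1 = n + k)%nat) by lia.
    set (c := (-1) ^ k / 2 ^ (p - 1) * Binomial.C p k).
    transitivity (Rsum (fun l => c * 2 ^ k * B ^ k *
      (Binomial.C n l * cos (alpha * x + (INR n - 2 * INR l) * (alpha * x)))) (seq 0 (S n))).
    + rewrite Rsum_scal, Rsum_binomial_cos. fold A.
      unfold c. rewrite E2, pow_add.
      replace (- B) with (-1 * B) by ring. rewrite Rpow_mult_distr.
      simpl. field. auto.
    + apply Rsum_ext. intros l _. rewrite Rsum_map.
      transitivity (c * Binomial.C n l * (2 ^ k * B ^ k *
                     cos (alpha * x + (INR n - 2 * INR l) * (alpha * x)))); [ring|].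
      unfold B. rewrite <- Rsum_binomial_cos, <- Rsum_scal.
      apply Rsum_ext. intros m _. unfold Lambda, chi.
      replace (k <? p)%nat with true by (symmetry; apply Nat.ltb_lt; lia).
      rewrite E1. fold c. rewrite Ep, S_INR. rewrite <- Rmult_assoc. f_equal.
      f_equal. ring.
  - destruct p as [|n]; [lia|].
    transitivity ((-1) ^ S n / 2 ^ n *
      Rsum (fun l => Binomial.C n l * cos (beta * x + (INR n - 2 * INR l) * (beta * x)))
        (seq 0 (S n))).
    + rewrite Rsum_binomial_cos. fold B.
      replace (- B) with (-1 * B) by ring. rewrite Rpow_mult_distr.
      simpl. field. auto.
    + rewrite <- Rsum_scal. apply Rsum_ext. intros l _. unfold Lambda, chi.
      rewrite Nat.ltb_irrefl. replace (S n - 1)%nat with n by lia.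
      rewrite S_INR, <- Rmult_assoc. f_equal. f_equal. ring.
Qed.

(** * No frequency of the expansion vanishes *)

(** The witness is [a = u], [k = 0]: the bound [a <= (p - 1) / 2] holds because
    [u < v] and [u + v <= p], and it makes [m_ab a p] equal to [0]. *)
Lemma in_F_ratio (p u v : nat) :
  (u < v)%nat -> (u + v <= p)%nat -> Nat.Odd (u + v) ->
  in_F (Z.of_nat p) (INR u / INR v).
Proof.
  intros Huv Hp [k Hk].
  exists (Z.of_nat u). split.
  { split; [lia|]. apply Z.div_le_lower_bound; lia. }
  exists (Z.of_nat u), (Z.of_nat v). repeat split; try lia.
  - exists 0%Z. split; [|lia]. split.
    + unfold m_ab. enough (Z.of_nat u <= (Z.of_nat p - 1) / 2)%Z by lia.
      apply Z.div_le_lower_bound; lia.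
    + apply Z.div_pos; lia.
  - exists (Z.of_nat k - Z.of_nat u)%Z. lia.
  - now rewrite <- !INR_IZR_INZ.
  - apply Rdiv_le_0_compat; [apply pos_INR | apply lt_0_INR; lia].
  - assert (0 < INR v) by (apply lt_0_INR; lia).
    apply Rmult_lt_reg_r with (INR v); [auto|].
    field_simplify; [apply lt_INR; auto | lra].
Qed.

Lemma in_F_0 (p : nat) : Nat.Odd p -> in_F (Z.of_nat p) 0.
Proof.
  intros [k Hk]. replace 0 with (INR 0 / INR 1) by (simpl; field).
  apply in_F_ratio; try lia. exists 0%nat; lia.
Qed.

Lemma Rabs_INR_minus (a b : nat) :
  exists d : nat, Rabs (INR a - INR b) = INR d /\ (d + a = b \/ d + b = a)%nat.
Proof.
  destruct (Nat.le_gt_cases a b).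
  - exists (b - a)%nat. rewrite Rabs_minus_sym, <- minus_INR by auto.
    split; [apply Rabs_pos_eq, pos_INR | lia].
  - exists (a - b)%nat. rewrite <- minus_INR by lia.
    split; [apply Rabs_pos_eq, pos_INR | lia].
Qed.

(** A vanishing frequency is a relation [d1 * |alpha| = d2 * |beta|] with
    [d1 <= p - k], [d2 <= k] and [d1 + d2] of the parity of [p], hence odd. So
    [d1] and [d2] differ, and the smaller over the larger is an element of
    [in_F] equal to one of the two ratios. For [k = p] the frequency is an odd
    multiple of [beta]. When [alpha] or [beta] is zero, so is
    one of the ratios, and [0] is in [in_F] too. *)
Lemma chi_neq_0 (alpha beta : R) (p : nat) :
  Nat.Odd p ->
  ~ in_F (Z.of_nat p) (Rabs (alpha / beta)) ->
  ~ in_F (Z.of_nat p) (Rabs (beta / alpha)) ->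
  forall t, Omega p t -> chi alpha beta p t 1 <> 0.
Proof.
  intros Hp HF1 HF2 [[k l] m] Ht.
  assert (Hb : beta <> 0).
  { intros ->. apply HF2. unfold Rdiv. rewrite Rmult_0_l, Rabs_R0. now apply in_F_0. }
  assert (Ha : alpha <> 0).
  { intros ->. apply HF1. unfold Rdiv. rewrite Rmult_0_l, Rabs_R0. now apply in_F_0. }
  destruct Hp as [h Hh]. unfold Omega, Omega1, Omega2 in Ht. simpl.
  destruct (Nat.ltb_spec k p) as [Hk|Hk]; rewrite !Rmult_1_r.
  - intros H0.
    destruct (Rabs_INR_minus (p - k) (2 * l)) as [d1 [E1 D1]].
    destruct (Rabs_INR_minus k (2 * m)) as [d2 [E2 D2]].
    rewrite mult_INR, minus_INR in E1 by lia. rewrite mult_INR in E2.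
    change (INR 2) with 2 in E1, E2.
    assert (HR : INR d1 * Rabs alpha = INR d2 * Rabs beta).
    { rewrite <- E1, <- E2, <- !Rabs_mult.
      rewrite <- (Rabs_Ropp (_ * beta)). f_equal. lra. }
    assert (Hodd : Nat.Odd (d1 + d2)).
    { exists ((d1 + d2) / 2)%nat.
      pose proof (Nat.div_mod_eq (d1 + d2) 2).
      pose proof (Nat.mod_upper_bound (d1 + d2) 2). lia. }
    assert (0 < Rabs alpha) by now apply Rabs_pos_lt.
    assert (0 < Rabs beta) by now apply Rabs_pos_lt.
    destruct (Nat.lt_total d1 d2) as [Hd|[Hd|Hd]].
    + apply HF2. rewrite Rabs_div by auto.
      assert (0 < INR d2) by (apply lt_0_INR; lia).
      replace (Rabs beta / Rabs alpha) with (INR d1 / INR d2).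
      * apply in_F_ratio; auto; lia.
      * apply Rmult_eq_reg_r with (INR d2 * Rabs alpha); [|nra].
        field_simplify; lra.
    + destruct Hodd; lia.
    + apply HF1. rewrite Rabs_div by auto.
      assert (0 < INR d1) by (apply lt_0_INR; lia).
      replace (Rabs alpha / Rabs beta) with (INR d2 / INR d1).
      * rewrite Nat.add_comm in Hodd. apply in_F_ratio; auto; lia.
      * apply Rmult_eq_reg_r with (INR d1 * Rabs beta); [|nra].
        field_simplify; lra.
  - apply Rmult_integral_contrapositive_currified; [|auto].
    change 2 with (INR 2). rewrite <- mult_INR. intros H0.
    apply Rminus_diag_uniq, INR_eq in H0. lia.
Qed.

(** * The integral *)

Theorem theorem4p2 (alpha beta : R) (p : nat)
  (Hab : Rabs alpha <> Rabs beta)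
  (Hp : Nat.Odd p)
  (HF1 : ~ in_F (Z.of_nat p) (Rabs (alpha / beta)))
  (HF2 : ~ in_F (Z.of_nat p) (Rabs (beta / alpha)))
  (N : nat) (r : nat -> triple)
  (Hr : is_enumeration (OmegaTilde alpha beta p) N r) :
  is_RInt_gen (fun x => (cos (alpha * x) - cos (beta * x)) ^ p / x)
    (at_right 0) (Rbar_locally p_infty)
    (sum_n_m (fun n => Xi alpha beta p 1 r n *
                       ln (Rabs (chi alpha beta p (r (n + 1)%nat) 1 /
                                 chi alpha beta p (r n) 1)))
       1 (N - 1)).
Proof.
  destruct Hr as (Hin & Hinj & Hsurj).
  pose proof (chi_neq_0 alpha beta p Hp HF1 HF2) as Hchi.
  assert (Hp0 : (0 < p)%nat) by (destruct Hp; lia).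
  assert (Hperm : Permutation (map r (seq 1 N)) (Omega_list p)).
  { apply NoDup_Permutation; [| apply NoDup_Omega_list |].
    - apply NoDup_map_NoDup_ForallPairs; [|apply seq_NoDup].
      intros i j Hi%in_seq Hj%in_seq. apply Hinj; lia.
    - intros t. rewrite in_Omega_list, in_map_iff by auto. split.
      + intros (j & <- & Hj%in_seq). apply Hin; lia.
      + intros Ht. destruct (Hsurj t) as (j & Hj & <-); [split; auto|].
        exists j. split; [auto | apply in_seq; lia]. }
  assert (Hreindex : forall F, Rsum F (Omega_list p) = Rsum (fun j => F (r j)) (seq 1 N)).
  { intros F. now rewrite <- (Rsum_Permutation F _ _ Hperm), Rsum_map. }
  assert (Hweight : Rsum (Lambda p) (Omega_list p) = 0).
  { transitivity ((cos (alpha * 0) - cos (beta * 0)) ^ p).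
    - rewrite cos_minus_cos_pow by auto. apply Rsum_ext. intros t _.
      rewrite Rmult_0_r, cos_0. ring.
    - rewrite !Rmult_0_r, Rminus_diag. apply pow_i, Hp0. }
  apply is_RInt_gen_ext with (fun x =>
    Rsum (fun t => Lambda p t * cos (chi alpha beta p t 1 * x)) (Omega_list p) / x).
  { apply filter_forall. intros ab x _. now rewrite <- cos_minus_cos_pow. }
  set (y := fun j => ln (Rabs (chi alpha beta p (r j) 1))).
  replace (sum_n_m _ 1 (N - 1)) with
    (- Rsum (fun t => Lambda p t * ln (Rabs (chi alpha beta p t 1))) (Omega_list p)).
  { apply is_RInt_gen_frullani_cos; [exact Hweight|].
    intros t Ht. apply Hchi. now apply in_Omega_list. }
  rewrite Hreindex in Hweight |- *. rewrite sum_n_m_Rsum.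
  destruct N as [|n].
  { simpl. ring. }
  replace (S n - 1)%nat with n by lia.
  transitivity (Rsum (fun i => Rsum (fun j => Lambda p (r j)) (seq 1 i)
                               * (y (i + 1)%nat - y i)) (seq 1 n)).
  - rewrite (Rsum_Abel (fun j => Lambda p (r j)) y), Hweight. unfold y. ring.
  - apply Rsum_ext. intros i Hi%in_seq. unfold Xi. rewrite sum_n_m_Rsum. f_equal.
    + apply Rsum_ext. intros j _. simpl. ring.
    + unfold y.
      destruct (Hin i) as [_ H0]; [lia|]. destruct (Hin (i + 1)%nat) as [_ H1]; [lia|].
      rewrite Rabs_div by auto. symmetry; apply ln_div; now apply Rabs_pos_lt.
Qed.
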